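(* Let $m$ be a positive integer and let $n_1,\dots,n_m$ be positive integers with greatest common divisor $(n_1,\dots,n_m)$. Then for every complex $s$ with $\operatorname{Re} s>0$, $$\frac{\sigma_{-s-1+m}\big((n_1,n_2,\dots,n_m)\big)}{\zeta(s+1)}=\sum_{k=1}^\infty \frac{c_k(n_1,n_2,\dots,n_m)}{k^{s+1}},$$ and for every complex $z$ with $|z|<1$, $$\exp\Big(\sum_{k\mid (n_1,\dots,n_m)} k^{m-1}z^k\Big)=\prod_{k=1}^\infty (1-z^k)^{-c_k(n_1,\dots,n_m)/k}.$$
   Context: For integers $k\ge 2$ and positive integers $n_1,\dots,n_m$, the generalized Ramanujan function is $$c_k(n_1,\dots,n_m)=\sum \exp\Big(\frac{2\pi i(j_1n_1+\dots+j_mn_m)}{k}\Big)=\sum\cos\Big(\frac{2\pi(j_1n_1+\dots+j_mn_m)}{k}\Big),$$ the sums running over all integer tuples $(j_1,\dots,j_m)$ with $0\le j_i<k$ for all $i$, $j_1+\dots+j_m\ne 0$ and $\gcd(j_1,\dots,j_m,k)=1$; and $c_1(n_1,\dots,n_m)=1$. Here $\sigma_w(n)=\sum_{d\mid n}d^w$ for complex $w$, $\zeta$ is the Riemann zeta function, and for $|z|<1$ the power $(1-z^k)^c$ means $\exp(c\,\mathrm{Log}(1-z^k))$ with the principal logarithm. *)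

(* Defs.v *)
From mathcomp Require Import all_boot all_order all_algebra complex.
From mathcomp Require Import all_classical all_reals all_analysis.

Set Implicit Arguments.
Unset Strict Implicit.
Unset Printing Implicit Defensive.

Import Order.TTheory GRing.Theory Num.Theory.
Import numFieldNormedType.Exports.

Local Open Scope ring_scope.
Local Open Scope classical_set_scope.

Section ComplexFunctions.
Variable R : realType.
Implicit Types z w : R[i].

Definition cexp z : R[i] :=
  let: (x +i* y)%C := z in
  ((expR x * cos y) +i* (expR x * sin y))%C.

(* The principal argument, in ]-pi, pi], of a nonzero complex number. *)
Definition carg z : R :=
  let: (x +i* y)%C := z in
  let t := acos (x / Num.sqrt (x ^+ 2 + y ^+ 2)) in
  if 0 <= y then t else - t.

Definition clog z : R[i] :=
  let: (x +i* y)%C := z in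
  (ln (Num.sqrt (x ^+ 2 + y ^+ 2)) +i* carg z)%C.

Definition cpow z w : R[i] := cexp (w * clog z).

(* Convergence in the norm topology of the complex plane. The regular module
   R[i]^o carries this topology; R[i] itself has no topological instance. *)
Definition ccvg (u : nat -> R[i]) (l : R[i]) : Prop :=
  (u : nat -> R[i]^o) @ \oo --> (l : R[i]^o).

Definition clim (u : nat -> R[i]) : R[i] :=
  limn (u : nat -> R[i]^o).

(* The Riemann zeta function as its Dirichlet series, hence only meaningful on
   the half-plane Re w > 1. *)
Definition zeta w : R[i] :=
  clim (fun N => \sum_(1 <= k < N.+1) (cpow k%:R w)^-1).

Definition sigma w (n : nat) : R[i] :=
  \sum_(d <- divisors n) cpow d%:R w.

End ComplexFunctions.

Definition gcd_fam (m : nat) (n : 'I_m -> nat) : nat := \big[gcdn/0%N]_(i < m) n i.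

Definition ramanujan (R : realType) (m k : nat) (n : 'I_m -> nat) : R[i] :=
  if k == 1%N then 1 else
  \sum_(j : {ffun 'I_m -> 'I_k} |
          (\sum_(i < m) (j i : nat) != 0)%N &&
          (gcdn (gcd_fam (fun i => j i : nat)) k == 1)%N)
    cexp (2 * (pi : R)%:C%C * 'i%C * (\sum_(i < m) j i * n i)%N%:R / k%:R).

(* Main.v *)
Require Import Defs.
From mathcomp Require Import all_boot all_order all_algebra complex ring lra.
From mathcomp Require Import all_classical all_reals all_analysis.
Set Implicit Arguments.
Unset Strict Implicit.
Unset Printing Implicit Defensive.
Import Order.TTheory GRing.Theory Num.Theory.
Import numFieldNormedType.Exports.
Local Open Scope ring_scope.

(* Detecting gcd(j, k) = 1 by the Moebius function turns c_k into the Dirichlet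
   convolution of the Moebius function with h, where h(q) = q^m if q divides
   g = (n_1, ..., n_m) and h(q) = 0 otherwise: the sum of exp(2 pi i j.n / q) over
   all j mod q is h(q). Hence sum_{d | N} c_d = h(N), and |c_k| is bounded by
   sum_{d | g} d^m.

   For the Dirichlet series, the product of the K-th partial sums of
   sum c_k k^-w and of zeta(w) differs by o(1) from sum_{N <= K} h(N) N^-w, which
   equals sigma_{m-w}(g) as soon as K >= g. The same argument for the Moebius
   function in place of c shows that zeta(w) is nonzero.

   For the product, the exponent of the K-th partial product is
   sum_{k <= K} (c_k / k) sum_l z^(kl) / l; keeping only the terms with kl <= K
   gives sum_{N <= K} h(N) z^N / N and costs O(K |z|^K). The series of the
   logarithm and its remainder come from the mean value theorem on the segment
   from 1 to 1 - z, applied to the real and imaginary parts. *)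

(** * Dirichlet convolution *)

(** A range that does not depend on [k] allows sums over divisors to be exchanged with an outer sum
    over [k]. *)
Lemma perm_divisors_range k K : (0 < k <= K)%N ->
  perm_eq (divisors k) [seq d <- index_iota 1 K.+1 | (d %| k)%N].
Proof.
case/andP=> k_gt0 kK; apply: uniq_perm; first exact: divisors_uniq.
  by rewrite filter_uniq // iota_uniq.
move=> d; rewrite -dvdn_divisors // mem_filter mem_index_iota ltnS.
case dk: (d %| k)%N => //=.
by rewrite (dvdn_gt0 k_gt0 dk) (leq_trans (dvdn_leq k_gt0 dk) kK).
Qed.

Lemma perm_divisors_multiples e k : (0 < k)%N -> (e %| k)%N ->
  perm_eq [seq d <- divisors k | (e %| d)%N]
          [seq (e * f)%N | f <- divisors (k %/ e)].
Proof.
move=> k_gt0 ek; have e_gt0 := dvdn_gt0 k_gt0 ek.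
have q_gt0 : (0 < k %/ e)%N by rewrite divn_gt0 // dvdn_leq.
apply: uniq_perm; first by rewrite filter_uniq // divisors_uniq.
  rewrite map_inj_uniq ?divisors_uniq // => a b /eqP.
  by rewrite eqn_pmul2l // => /eqP.
move=> d; rewrite mem_filter -dvdn_divisors //; apply/andP/mapP.
  case=> ed dk; exists (d %/ e)%N; last by rewrite mulnC divnK.
  by rewrite -dvdn_divisors // dvdn_divRL // divnK.
case=> f; rewrite -dvdn_divisors // => fk ->; split; first exact: dvdn_mulr.
by rewrite -(divnK ek) mulnC dvdn_pmul2r.
Qed.

Section Convolution.
Variable A : comRingType.
Implicit Types f g h : nat -> A.

Definition dconv f g k : A := \sum_(d <- divisors k) f d * g (k %/ d)%N.

(** Both sides run over chains [e %| d], [d %| k] with summand [f e * g (d %/ e) * h (k %/ d)]; on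
    the left, the inner divisor of [k %/ e] is multiplied by [e]. *)
Lemma dconvA f g h k : (0 < k)%N ->
  dconv f (dconv g h) k = dconv (dconv f g) h k.
Proof.
move=> k_gt0; rewrite /dconv.
have dvdE (r : pred nat) (F : nat -> A) j : (0 < j)%N ->
    \sum_(d <- divisors j | r d) F d = \sum_(d <- divisors j | (d %| j)%N && r d) F d.
  move=> j0; rewrite big_seq_cond [RHS]big_seq_cond; apply: eq_bigl => d.
  by rewrite -dvdn_divisors //; case: (d %| j)%N.
transitivity (\sum_(e <- divisors k) \sum_(d <- divisors k | (e %| d)%N)
    f e * g (d %/ e)%N * h (k %/ d)%N).
  rewrite dvdE // [RHS]dvdE //; apply: eq_bigr => e; rewrite andbT => ek.
  have e_gt0 := dvdn_gt0 k_gt0 ek.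
  rewrite -[RHS]big_filter (perm_big _ (perm_divisors_multiples k_gt0 ek)) /=.
  rewrite big_map mulr_sumr; apply: eq_bigr => d _.
  by rewrite mulKn // mulrA divnMA.
rewrite [LHS](exchange_big_dep xpredT) //=.
rewrite dvdE // [RHS]dvdE //; apply: eq_bigr => d; rewrite andbT => dk.
have d_gt0 := dvdn_gt0 k_gt0 dk.
rewrite mulr_suml -big_filter; apply: perm_big.
apply: uniq_perm; rewrite ?filter_uniq ?divisors_uniq //.
move=> e; rewrite mem_filter -!dvdn_divisors //.
by case ed: (e %| d)%N; rewrite //= (dvdn_trans ed dk).
Qed.

Lemma eq_dconv f f' g g' k : (0 < k)%N ->
  (forall d, (0 < d)%N -> f d = f' d) -> (forall d, (0 < d)%N -> g d = g' d) ->
  dconv f g k = dconv f' g' k.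
Proof.
move=> k_gt0 ff gg; rewrite /dconv big_seq [RHS]big_seq; apply: eq_bigr => d.
rewrite -dvdn_divisors // => dk; have d_gt0 := dvdn_gt0 k_gt0 dk.
by rewrite ff // gg // divn_gt0 // dvdn_leq.
Qed.

(** The involution sending [d] to [k %/ d] permutes the divisors of [k]. *)
Lemma dconvC f g k : (0 < k)%N -> dconv f g k = dconv g f k.
Proof.
move=> k_gt0; rewrite /dconv.
have codivK a : (a %| k)%N -> (k %/ (k %/ a))%N = a.
  by move=> ak; rewrite divnA // mulKn.
have E : perm_eq (divisors k) [seq (k %/ d)%N | d <- divisors k].
  apply: uniq_perm; rewrite ?divisors_uniq //.
    rewrite map_inj_in_uniq ?divisors_uniq // => a b.
    by rewrite -!dvdn_divisors // => ak bk eab; rewrite -(codivK a) // eab codivK.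
  move=> d; rewrite -dvdn_divisors //; apply/idP/mapP.
    by move=> dk; exists (k %/ d)%N; rewrite ?codivK // -dvdn_divisors // dvdn_div.
  by case=> e; rewrite -dvdn_divisors // => ek ->; rewrite dvdn_div.
rewrite (perm_big _ E) /= big_map big_seq [RHS]big_seq; apply: eq_bigr => d.
by rewrite -dvdn_divisors // => dk; rewrite codivK // mulrC.
Qed.

Lemma dconv1 f k : (0 < k)%N -> dconv f (fun d => (d == 1%N)%:R) k = f k.
Proof.
move=> k_gt0; rewrite /dconv (bigD1_seq k) ?divisors_uniq //=; last first.
  by rewrite -dvdn_divisors.
rewrite divnn k_gt0 mulr1 big_seq_cond big1 ?addr0 // => d.
rewrite -dvdn_divisors // => /andP[dk nk].
by rewrite eq_sym eqn_div ?(dvdn_gt0 k_gt0 dk) // mul1n (negPf nk) mulr0.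
Qed.

Definition moebius k : A :=
  \prod_(p <- primes k) (if logn p k == 1%N then -1 else 0).

Lemma moebius_prime_mul p e : prime p -> (0 < e)%N -> ~~ (p %| e)%N ->
  moebius (p * e) = - moebius e.
Proof.
move=> p_pr e_gt0 pe; have p_gt0 := prime_gt0 p_pr.
have E : perm_eq (primes (p * e)) (p :: primes e).
  apply: uniq_perm; rewrite ?primes_uniq //=.
    by rewrite primes_uniq mem_primes (negPf pe) !andbF.
  by move=> q; rewrite primesM // primes_prime // !inE.
rewrite /moebius (perm_big _ E) /= big_cons lognM //.
rewrite -[p in logn p p]expn1 pfactorK // logn_coprime ?prime_coprime // mulN1r.
congr (- _); rewrite big_seq [RHS]big_seq; apply: eq_bigr => q.
rewrite mem_primes => /and3P[q_pr _ qe]; rewrite lognM // logn_prime //.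
by case: (q =P p) => // qp; rewrite -qp qe in pe.
Qed.

Lemma moebius_sqr p d : prime p -> (0 < d)%N -> (p ^ 2 %| d)%N -> moebius d = 0.
Proof.
move=> p_pr d_gt0; rewrite pfactor_dvdn // => l2; rewrite /moebius.
have pd : p \in primes d by rewrite -logn_gt0 (leq_trans _ l2).
by rewrite (bigD1_seq p) ?primes_uniq //= gtn_eqF // mul0r.
Qed.

(** For [k > 1] let [p] be its least prime factor. Divisors divisible by [p ^ 2] contribute 0; the
    others pair off as [e] and [p * e], with opposite values. *)
Lemma sum_moebius k : (0 < k)%N -> \sum_(d <- divisors k) moebius d = (k == 1%N)%:R.
Proof.
move=> k_gt0; have [->|k1] := eqVneq k 1%N.
  by rewrite [divisors 1]/= big_seq1 /moebius big_nil.
have k_gt1 : (1 < k)%N by rewrite ltn_neqAle eq_sym k1.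
pose p := pdiv k; have p_pr : prime p := pdiv_prime k_gt1.
have p_gt0 := prime_gt0 p_pr.
rewrite (bigID (fun d => (p %| d)%N)) /= (bigID (fun d => (p ^ 2 %| d)%N)) /=.
rewrite [X in X + _ + _]big_seq_cond [X in X + _ + _]big1 ?add0r; last first.
  move=> d; rewrite -dvdn_divisors // => /and3P[dk pd p2d].
  exact: moebius_sqr (dvdn_gt0 k_gt0 dk) p2d.
have E : perm_eq [seq d <- divisors k | (p %| d)%N && ~~ (p ^ 2 %| d)%N]
    [seq (p * e)%N | e <- [seq e <- divisors k | ~~ (p %| e)%N]].
  apply: uniq_perm; first by rewrite filter_uniq // divisors_uniq.
    rewrite map_inj_uniq ?filter_uniq ?divisors_uniq // => a b /eqP.
    by rewrite eqn_pmul2l // => /eqP.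
  move=> d; rewrite mem_filter -dvdn_divisors //; apply/andP/mapP.
    case=> /andP[/dvdnP[e ->]]; rewrite dvdn_pmul2r // => pe ek.
    exists e; last by rewrite mulnC.
    by rewrite mem_filter pe -dvdn_divisors // (dvdn_trans _ ek) ?dvdn_mulr.
  case=> e; rewrite mem_filter -dvdn_divisors // => /andP[pe ek] ->.
  rewrite dvdn_mulr // dvdn_pmul2l // pe Gauss_dvd ?pdiv_dvd //.
  by rewrite prime_coprime.
rewrite -big_filter (perm_big _ E) /= big_map -[X in _ + X]big_filter -big_split /=.
rewrite big_seq big1 // => e; rewrite mem_filter -dvdn_divisors // => /andP[pe ek].
by rewrite moebius_prime_mul ?addNr // (dvdn_gt0 k_gt0 ek).
Qed.

End Convolution.

(** The pairs under the hyperbola [k * l = K] are grouped by their product [N]. Both halves of the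
    theorem compare a double sum with this one. *)
Lemma sum_divisors_hyperbola (V : nmodType) (F : nat -> nat -> V) K :
  \sum_(1 <= N < K.+1) \sum_(d <- divisors N) F d (N %/ d)%N =
  \sum_(1 <= k < K.+1) \sum_(1 <= l < K.+1 | (k * l <= K)%N) F k l.
Proof.
transitivity (\sum_(1 <= N < K.+1) \sum_(1 <= d < K.+1 | (d %| N)%N) F d (N %/ d)%N).
  rewrite big_seq [RHS]big_seq; apply: eq_bigr => N.
  rewrite mem_index_iota ltnS => NK.
  by rewrite (perm_big _ (perm_divisors_range NK)) big_filter.
rewrite (exchange_big_dep xpredT) //= big_seq [RHS]big_seq.
apply: eq_bigr => d; rewrite mem_index_iota ltnS => /andP[d_gt0 dK].
rewrite -[LHS]big_filter -[RHS]big_filter.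
have E : perm_eq [seq N <- index_iota 1 K.+1 | (d %| N)%N]
    [seq (d * l)%N | l <- [seq l <- index_iota 1 K.+1 | (d * l <= K)%N]].
  apply: uniq_perm; first by rewrite filter_uniq // iota_uniq.
    rewrite map_inj_uniq ?filter_uniq ?iota_uniq // => a b /eqP.
    by rewrite eqn_pmul2l // => /eqP.
  move=> N; rewrite mem_filter mem_index_iota ltnS; apply/idP/mapP.
    case/and3P=> /dvdnP[e ->]; rewrite muln_gt0 => /andP[e_gt0 _] edK.
    exists e; last by rewrite mulnC.
    rewrite mem_filter mem_index_iota mulnC edK e_gt0 ltnS /=.
    by rewrite (leq_trans _ edK) // leq_pmulr.
  case=> e; rewrite mem_filter mem_index_iota => /and3P[edK e_gt0 _] ->.
  by rewrite dvdn_mulr // muln_gt0 d_gt0 e_gt0.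
rewrite (perm_big _ E) /= big_map; apply: eq_bigr => l _.
by rewrite mulKn.
Qed.

(** * Ramanujan sums *)

Section Exponential.
Variable R : realType.
Implicit Types z w : R[i].

Lemma cexp0 : cexp (0 : R[i]) = 1.
Proof. by rewrite /cexp /= expR0 cos0 sin0 mulr0 mulr1. Qed.

Lemma cexpD z w : cexp (z + w) = cexp z * cexp w.
Proof.
case: z w => [a b] [c d]; rewrite /cexp /= expRD cosD sinD.
by apply/eqP; rewrite eq_complex /=; apply/andP; split; apply/eqP; ring.
Qed.

Lemma cexp_sum I (r : seq I) (P : pred I) (F : I -> R[i]) :
  cexp (\sum_(i <- r | P i) F i) = \prod_(i <- r | P i) cexp (F i).
Proof. exact: (big_morph _ cexpD cexp0). Qed.

Lemma cexpX z n : cexp (n%:R * z) = cexp z ^+ n.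
Proof.
elim: n => [|n IH]; first by rewrite mul0r cexp0.
by rewrite -natr1 mulrDl mul1r cexpD IH exprSr.
Qed.

Lemma normc_cexp z : `|cexp z| = (expR (complex.Re z))%:C%C.
Proof.
case: z => a b; rewrite normc_def /=; congr (_ +i* _)%C.
have -> : (expR a * cos b) ^+ 2 + (expR a * sin b) ^+ 2 =
  expR a ^+ 2 * (cos b ^+ 2 + sin b ^+ 2) by ring.
by rewrite cos2Dsin2 mulr1 sqrtr_sqr ger0_norm ?expR_ge0.
Qed.

Lemma cexp_neq0 z : cexp z != 0.
Proof.
by rewrite -normr_eq0 normc_cexp; apply/eqP => -[] /eqP; rewrite expR_eq0.
Qed.

Lemma cexpN z : cexp (- z) = (cexp z)^-1.
Proof. by apply: (mulfI (cexp_neq0 z)); rewrite -cexpD subrr cexp0 divff ?cexp_neq0. Qed.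

End Exponential.

(** * Roots of unity and their power sums *)

Section RootsOfUnity.
Variable R : realType.

(** Written exactly as the summand of [ramanujan], so that the two agree by conversion. *)
Definition unity_root (k a : nat) : R[i] :=
  cexp (2 * (pi : R)%:C%C * 'i%C * a%:R / k%:R).

Lemma unity_rootE k a :
  unity_root k a = let t := pi * a%:R / k%:R in (cos (t *+ 2) +i* sin (t *+ 2))%C.
Proof.
rewrite /unity_root /=; set t := pi * _ / _.
have -> : 2 * (pi : R)%:C%C * 'i%C * a%:R / k%:R = (0 +i* (t *+ 2))%C.
  have -> : (0 +i* (t *+ 2))%C = 'i%C * (t *+ 2)%:C%C.
    by apply/eqP; rewrite eq_complex /=; apply/andP; split; apply/eqP; ring.
  have -> : t *+ 2 = 2 * (pi * a%:R / k%:R) by rewrite /t; ring.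
  rewrite !rmorphM /= fmorphV /= !rmorph_nat.
  by ring.
by rewrite /cexp expR0 !mul1r.
Qed.

Lemma unity_root0 k : unity_root k 0 = 1.
Proof. by rewrite /unity_root mulr0 mul0r cexp0. Qed.

Lemma unity_rootD k a b : unity_root k (a + b) = unity_root k a * unity_root k b.
Proof. by rewrite /unity_root natrD mulrDr mulrDl cexpD. Qed.

Lemma unity_rootM k a b : unity_root k (b * a) = unity_root k a ^+ b.
Proof. by rewrite /unity_root -cexpX natrM; congr cexp; ring. Qed.

Lemma unity_root_reduce d k a : (0 < d)%N -> unity_root (d * k) (d * a) = unity_root k a.
Proof.
move=> d_gt0; rewrite /unity_root !natrM invfM; congr cexp.
have d0 : d%:R != 0 :> R[i] by rewrite pnatr_eq0 -lt0n.
transitivity (2 * (pi : R)%:C%C * 'i%C * a%:R / k%:R * (d%:R / d%:R)); first by ring.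
by rewrite divff // mulr1.
Qed.

Lemma unity_rootkk k : (0 < k)%N -> unity_root k k = 1.
Proof.
move=> k_gt0; rewrite unity_rootE /= -mulrA divff ?pnatr_eq0 -?lt0n // mulr1.
by rewrite cos2pi sin_mulr2n sinpi mulr0 mul0rn.
Qed.

Lemma unity_root_eq1 k a : (0 < k)%N -> (unity_root k a == 1) = (k %| a)%N.
Proof.
move=> k_gt0; rewrite {1}(divn_eq a k) unity_rootD unity_rootM unity_rootkk //.
rewrite expr1n mul1r /dvdn; case: (posnP (a %% k)%N) => [->|r_gt0].
  by rewrite unity_root0 !eqxx.
(* For a nonzero remainder the half angle [t] lies strictly between 0 and [pi], so [sin t > 0] and
   the real part, [cos] of the double angle, is less than 1. *)
apply/negbTE/eqP.
rewrite unity_rootE /=; set t := _ / _ => -[] /eqP + _.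
have tpi : 0 < t < pi.
  rewrite /t -mulrA mulr_gt0 ?pi_gt0 ?divr_gt0 ?ltr0n //=.
  by rewrite gtr_pMr ?pi_gt0 // ltr_pdivrMr ?ltr0n // mul1r ltr_nat ltn_mod.
have st := sin_gt0_pi tpi.
have cs := cos2Dsin2 t.
rewrite cos_mulr2n => /eqP e.
have : 0 < sin t ^+ 2 by rewrite exprn_gt0.
by lra.
Qed.

(** A geometric sum whose ratio [unity_root k a] has [k]-th power 1. *)
Lemma sum_unity_root k a : (0 < k)%N ->
  \sum_(b < k) unity_root k (b * a) = if (k %| a)%N then k%:R else 0.
Proof.
move=> k_gt0; rewrite -unity_root_eq1 //.
under eq_bigr do rewrite unity_rootM.
case: eqP => [->|/eqP n1].
  by under eq_bigr do rewrite expr1n; rewrite sumr_const card_ord.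
apply: (@mulfI _ (unity_root k a - 1)); first by rewrite subr_eq0.
rewrite -subrX1 mulr0 -unity_rootM mulnC unity_rootM unity_rootkk //.
by rewrite expr1n subrr.
Qed.

(** Writing the multiples of [d] as [d * b] and cancelling [d] leaves a complete sum modulo
    [k %/ d]. *)
Lemma sum_unity_root_multiples d k a : (0 < k)%N -> (d %| k)%N ->
  \sum_(b < k | (d %| b)%N) unity_root k (b * a) =
  if (k %/ d %| a)%N then (k %/ d)%N%:R else 0.
Proof.
move=> k_gt0 dk; have d_gt0 := dvdn_gt0 k_gt0 dk.
have q_gt0 : (0 < k %/ d)%N by rewrite divn_gt0 // dvdn_leq.
rewrite -(sum_unity_root a q_gt0).
rewrite -(big_mkord (fun b => d %| b)%N (fun b => unity_root k (b * a))).
rewrite -(big_mkord predT (fun b => unity_root (k %/ d) (b * a))) -big_filter.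
have E : perm_eq [seq b <- index_iota 0 k | (d %| b)%N]
    [seq (d * b)%N | b <- index_iota 0 (k %/ d)].
  apply: uniq_perm; first by rewrite filter_uniq // iota_uniq.
    rewrite map_inj_uniq ?iota_uniq // => x y /eqP.
    by rewrite eqn_pmul2l // => /eqP.
  move=> b; rewrite mem_filter mem_index_iota /=; apply/andP/mapP.
    case=> /dvdnP[e ->] ek; exists e; last by rewrite mulnC.
    by rewrite mem_index_iota /= ltn_divRL.
  case=> e; rewrite mem_index_iota /= ltn_divRL // mulnC => ek ->.
  by rewrite mulnC dvdn_mull // mulnC.
rewrite (perm_big _ E) /= big_map; apply: eq_bigr => b _.
by rewrite -mulnA -{1}(divnK dk) [(_ %/ _ * _)%N]mulnC unity_root_reduce.
Qed.

End RootsOfUnity.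

(** * Moebius inversion for the Ramanujan function *)

Section Ramanujan.
Variables (R : realType) (m : nat) (n : 'I_m -> nat).

(** The function [h] of the overview. *)
Definition power_divisor (q : nat) : R[i] :=
  if (q %| gcd_fam n)%N then q%:R ^+ m else 0.

Lemma dvdn_gcd_fam d (f : 'I_m -> nat) :
  (d %| gcd_fam f)%N = [forall i, (d %| f i)%N].
Proof.
apply/dvdn_biggcdP/forallP => [h i|h i _]; first exact: h.
exact: h.
Qed.

(** Only the zero tuple is at stake. For [k > 1] its gcd with [k] is [k], so it fails the gcd test;
    for [k = 1] it is the only tuple and contributes the prescribed value 1. *)
Lemma ramanujan_coprime_sum k : (0 < k)%N ->
  ramanujan R k n = \sum_(j : {ffun 'I_m -> 'I_k} |
      (gcdn (gcd_fam (fun i => j i : nat)) k == 1)%N)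
    unity_root R k (\sum_(i < m) j i * n i)%N.
Proof.
rewrite /ramanujan => k_gt0; case: (k =P 1%N) k_gt0 => [->|/eqP k1] k_gt0.
  rewrite (eq_bigl predT) => [|j]; last by rewrite gcdn1.
  rewrite (eq_bigr (fun=> 1)) => [|j _]; last first.
    by apply/eqP; rewrite unity_root_eq1 // dvd1n.
  by rewrite sumr_const cardT -cardE card_ffun !card_ord exp1n.
apply: eq_bigl => j; case: eqP => //= s0.
apply/esym/negP => /eqP g1.
have : (k %| 1)%N.
  rewrite -g1 dvdn_gcd dvdnn andbT dvdn_gcd_fam; apply/forallP => i.
  by move/eqP: s0; rewrite sum_nat_eq0 => /forall_inP/(_ i isT)/eqP ->.
by rewrite dvdn1 (negPf k1).
Qed.

Lemma ramanujan_dconv k : (0 < k)%N ->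
  ramanujan R k n = dconv (moebius R[i]) power_divisor k.
Proof.
move=> k_gt0; rewrite ramanujan_coprime_sum // big_mkcond /=.
transitivity (\sum_(j : {ffun 'I_m -> 'I_k})
    \sum_(d <- divisors k | (d %| gcd_fam (fun i => j i : nat))%N)
      moebius R[i] d * unity_root R k (\sum_(i < m) j i * n i)%N).
  apply: eq_bigr => j _; set g := gcd_fam _; set u := unity_root _ _ _.
  have g0 : (0 < gcdn g k)%N by rewrite gcdn_gt0 k_gt0 orbT.
  rewrite -mulr_suml.
  have -> : \sum_(d <- divisors k | (d %| g)%N) moebius R[i] d =
      \sum_(d <- divisors (gcdn g k)) moebius R[i] d.
    rewrite -big_filter; apply: perm_big.
    apply: uniq_perm; rewrite ?filter_uniq ?divisors_uniq //.
    by move=> d; rewrite mem_filter -!dvdn_divisors // dvdn_gcd.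
  by rewrite sum_moebius //; case: eqP => _; rewrite ?mul1r ?mul0r.
rewrite (exchange_big_dep xpredT) //= /dconv big_seq [RHS]big_seq.
apply: eq_bigr => d; rewrite -dvdn_divisors // => dk.
rewrite -mulr_sumr; congr (_ * _).
(* The divisibility condition and the exponential both split over the coordinates, so the sum over
   tuples is a product of one-variable sums. Each factor is [k %/ d], or 0 when [k %/ d] fails to
   divide [n i]. *)
transitivity (\sum_(j in ffun_on [pred a : 'I_k | (d %| a)%N])
    \prod_i unity_root R k (j i * n i)).
  apply: eq_big => j.
    rewrite dvdn_gcd_fam; apply/forallP/ffun_onP => h i; first exact: h.
    exact: h.
  by move=> _; rewrite (big_morph (unity_root R k) (unity_rootD R k) (unity_root0 R k)).
rewrite -(bigA_distr_big _ (fun i (a : 'I_k) => unity_root R k (a * n i))) /=.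
under eq_bigr do rewrite sum_unity_root_multiples //.
rewrite /power_divisor dvdn_gcd_fam; case: ifPn => [/forallP h|].
  under eq_bigr => i _ do rewrite h.
  by rewrite prodr_const card_ord.
rewrite negb_forall => /existsP[i /negPf h].
by rewrite (bigD1 i) //= h mul0r.
Qed.

(** Moebius inversion: by associativity, the constant 1 convolved with [moebius] gives the unit of
    the convolution, leaving [power_divisor]. *)
Lemma sum_ramanujan N : (0 < N)%N ->
  \sum_(d <- divisors N) ramanujan R d n = power_divisor N.
Proof.
move=> N_gt0; transitivity (dconv (fun d => ramanujan R d n) (fun=> 1) N).
  by apply: eq_bigr => d _; rewrite mulr1.
have E (f g : nat -> R[i]) : (forall d, (0 < d)%N -> f d = g d) ->
    dconv (fun=> 1) f N = dconv (fun=> 1) g N.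
  by move=> fg; apply: eq_dconv.
rewrite dconvC // (E _ _ ramanujan_dconv) dconvA //.
rewrite dconvC // -[RHS]dconv1 //; apply: eq_dconv => // d d_gt0.
rewrite dconvC // -sum_moebius //; apply: eq_bigr => e _.
by rewrite mulr1.
Qed.

End Ramanujan.

(** * The complex logarithm *)

Section ComplexNorm.
Variable R : realType.
Implicit Types (z w : R[i]) (r : R).

Lemma norm_real_complex r : `|r%:C%C : R[i]| = `|r|%:C%C.
Proof. by rewrite normc_def /= expr0n addr0 sqrtr_sqr. Qed.

Lemma norm_imaginary_unit : `|'i%C : R[i]| = 1.
Proof. by rewrite normc_def /= expr0n expr1n add0r sqrtr1. Qed.

Lemma Re_norm_le z r : `|z| <= r%:C%C -> `|complex.Re z| <= r.
Proof. by move=> zr; rewrite -lecR (le_trans (normc_ge_Re z)). Qed.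

(** The imaginary part of [z] is the real part of [- 'i * z], which has the same norm. *)
Lemma Im_norm_le z r : `|z| <= r%:C%C -> `|complex.Im z| <= r.
Proof.
move=> zr; have := @Re_norm_le (- 'i%C * z) r.
rewrite normrM normrN norm_imaginary_unit.
rewrite mul1r => /(_ zr); congr (`|_| <= _).
by case: z {zr} => a b /=; ring.
Qed.

Lemma norm_le_Re_Im z : `|z| <= (`|complex.Re z| + `|complex.Im z|)%:C%C.
Proof.
rewrite {1}(complexE z) rmorphD /= (le_trans (ler_normD _ _)) // normrM norm_imaginary_unit.
by rewrite mul1r !norm_real_complex.
Qed.

(** Norms in [R[i]] are complex numbers; this moves an order argument to [R]. *)
Lemma norm_complex_real z : exists2 r, 0 <= r & `|z| = r%:C%C.
Proof. by rewrite normc_def; eexists; last by []; rewrite sqrtr_ge0. Qed.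

End ComplexNorm.

Section ComplexLogarithm.
Variable R : realType.
Implicit Types (z w : R[i]) (t r : R).

(** On the right half-plane the logarithm takes a form with no case split on the sign of [b], fit
    for differentiation. *)
Lemma clog_Re_gt0 (a b : R) : 0 < a ->
  clog (a +i* b)%C = (ln (a ^+ 2 + b ^+ 2) / 2 +i* atan (b / a))%C.
Proof.
move=> a0; have q0 : 0 < a ^+ 2 + b ^+ 2 by rewrite ltr_wpDr ?sqr_ge0 ?exprn_gt0.
rewrite /clog /carg; set q := _ + b ^+ 2 in q0 *.
have sq0 : 0 < Num.sqrt q by rewrite sqrtr_gt0.
congr (_ +i* _)%C.
  by rewrite -{2}(sqr_sqrtr (ltW q0)) lnXn // mulr2n -mulr2n -[_ *+ 2]mulr_natr mulfK.
have -> : a / Num.sqrt q = cos (atan (b / a)).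
  rewrite cos_atan; have -> : q = a ^+ 2 * (1 + (b / a) ^+ 2).
    by rewrite /q; field; rewrite gt_eqF.
  rewrite sqrtrM ?sqr_ge0 // sqrtr_sqr gtr0_norm // invfM mulrA divff ?mul1r //.
  by rewrite gt_eqF.
have hi := atan_ltpi2 (b / a); have lo := atan_gtNpi2 (b / a).
have pp := pi_gt0 R.
(* [acos (cos t)] is the absolute value of [t] for [t] in this range; the branch of [carg] restores
   the sign, which is that of [b]. *)
case: ifPn => [b0|]; last rewrite -ltNge => b0.
  have t0 : 0 <= atan (b / a).
    by rewrite -[X in X <= _]atan0 le_atan // divr_ge0 // ltW.
  by rewrite cosK // in_itv /= t0 /=; lra.
have t0 : atan (b / a) <= 0.
  by rewrite -[X in _ <= X]atan0 le_atan // pmulr_lle0 ?invr_gt0 // ltW.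
by rewrite cosKN ?opprK // t0 andbT; lra.
Qed.

Lemma is_derive_sum_pow (c : nat -> R) L t :
  is_derive t 1 (fun t => \sum_(1 <= l < L.+1) c l / l%:R * t ^+ l)
    (\sum_(1 <= l < L.+1) c l * t ^+ l.-1).
Proof.
pose p : {poly R} := \sum_(1 <= l < L.+1) (c l / l%:R) *: 'X^l.
have -> : (fun t => \sum_(1 <= l < L.+1) c l / l%:R * t ^+ l) = horner p.
  apply/funext => u; rewrite horner_sum; apply: eq_bigr => l _.
  by rewrite hornerZ hornerXn.
refine (is_derive_eq (is_derive_poly p t) _).
rewrite raddf_sum horner_sum /= big_nat [RHS]big_nat; apply: eq_bigr => l /andP[l0 _].
rewrite derivZ derivXn hornerZ hornerMn hornerXn mulrnAr -mulrnAl.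
rewrite -[(_ / _) *+ l]mulr_natr divfK //.
by rewrite pnatr_eq0 -lt0n.
Qed.

(** With [z = x + i y], these are the real parts of [- clog (1 - t * z)] and of its derivative
    [z / (1 - t * z)]. *)
Lemma is_derive_half_ln (x y t : R) : 0 < 1 - t * x ->
  is_derive t 1 (fun t => - (ln ((1 - t * x) ^+ 2 + (- (t * y)) ^+ 2) / 2))
   (((1 - t * x) * x - t * y * y) / ((1 - t * x) ^+ 2 + (- (t * y)) ^+ 2)).
Proof.
move=> a0.
pose p : {poly R} := (1 - x *: 'X) ^+ 2 + (- (y *: 'X)) ^+ 2.
have pE u : p.[u] = (1 - u * x) ^+ 2 + (- (u * y)) ^+ 2.
  by rewrite /p !hornerE; ring.
have q0 : 0 < p.[t] by rewrite pE ltr_wpDr ?sqr_ge0 ?exprn_gt0.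
have -> : (fun t => - (ln ((1 - t * x) ^+ 2 + (- (t * y)) ^+ 2) / 2)) =
    (- 2^-1) \*: ((@ln R) \o horner p).
  by apply/funext => u; rewrite /= pE /GRing.scale /=; ring.
refine (is_derive_eq (is_deriveZ _ (is_derive1_comp (is_derive1_ln q0) (is_derive_poly p t))) _).
have -> : p^`().[t] = - 2 * ((1 - t * x) * x - t * y * y).
  rewrite /p derivD !deriv_exp derivB derivN !derivZ derivC derivX !hornerE /=.
  by ring.
rewrite -pE /GRing.scale /=; field.
by rewrite gt_eqF.
Qed.

(** The imaginary parts of the same two functions. *)
Lemma is_derive_atan_quotient (x y t : R) : 0 < 1 - t * x ->
  is_derive t 1 (fun t => - atan (- (t * y) / (1 - t * x)))
   (y / ((1 - t * x) ^+ 2 + (- (t * y)) ^+ 2)).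
Proof.
move=> a0.
pose a : {poly R} := 1 - x *: 'X.
pose b : {poly R} := - (y *: 'X).
have aE u : a.[u] = 1 - u * x by rewrite /a !hornerE; ring.
have bE u : b.[u] = - (u * y) by rewrite /b !hornerE; ring.
have at0 : a.[t] != 0 by rewrite aE gt_eqF.
have -> : (fun t => - atan (- (t * y) / (1 - t * x))) =
    - ((@atan R) \o (horner b * (fun u => (a.[u])^-1))).
  by apply/funext => u; rewrite /= -aE -bE.
have H := is_deriveN (is_derive1_comp (is_derive1_atan _)
   (is_deriveM (is_derive_poly b t) (is_deriveV at0 (is_derive_poly a t)))).
refine (is_derive_eq H _).
have -> : a^`().[t] = - x.
  by rewrite /a derivB derivZ derivC derivX !hornerE /=; ring.
have -> : b^`().[t] = - y.
  by rewrite /b derivN derivZ derivX !hornerE /=; ring.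
rewrite /= -[(horner b * _) t]/(b.[t] * _) !aE !bE /GRing.scale /=.
have q0 : 0 < (1 - t * x) ^+ 2 + (- (t * y)) ^+ 2.
  by rewrite ltr_wpDr ?sqr_ge0 ?exprn_gt0.
field; rewrite !gt_eqF //.
Qed.

(** The mean value theorem on an interval of length 1, for [f] minus the polynomial that integrates
    the truncated series; this difference vanishes at 0. *)
Lemma power_series_remainder (f df : R -> R) (c : nat -> R) L (M : R) :
  (forall t, t \in `[0, 1] -> is_derive t 1 f (df t)) -> f 0 = 0 ->
  (forall t, t \in `[0, 1] ->
     `|df t - \sum_(1 <= l < L.+1) c l * t ^+ l.-1| <= M) ->
  `|f 1 - \sum_(1 <= l < L.+1) c l / l%:R| <= M.
Proof.
move=> fdf f0 dM.
pose p t := \sum_(1 <= l < L.+1) c l / l%:R * t ^+ l.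
have gD t : t \in `[0, 1] ->
    is_derive t 1 (f - p) (df t - \sum_(1 <= l < L.+1) c l * t ^+ l.-1).
  by move=> t01; apply: is_deriveB; [exact: fdf|exact: is_derive_sum_pow].
have [|t t01] := MVT_segment ler01 (fun t ht => gD t (subset_itv_oo_cc ht)).
  apply: derivable_within_continuous => t t01.
  by have [] := gD t t01.
have -> : (f - p) 1 - (f - p) 0 = f 1 - \sum_(1 <= l < L.+1) c l / l%:R.
  have p0 : p 0 = 0.
    by rewrite /p big_nat big1 // => l /andP[l0 _]; rewrite expr0n gtn_eqF // mulr0.
  rewrite -[(f - p) 1]/(f 1 - p 1) -[(f - p) 0]/(f 0 - p 0) f0 p0 !subr0.
  by congr (_ - _); apply: eq_bigr => l _; rewrite expr1n mulr1.
by move=> ->; rewrite subr0 mulr1; apply: dM.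
Qed.

Lemma Re_sum I (s : seq I) (P : pred I) (F : I -> R[i]) :
  complex.Re (\sum_(i <- s | P i) F i) = \sum_(i <- s | P i) complex.Re (F i).
Proof. exact: raddf_sum. Qed.

Lemma Im_sum I (s : seq I) (P : pred I) (F : I -> R[i]) :
  complex.Im (\sum_(i <- s | P i) F i) = \sum_(i <- s | P i) complex.Im (F i).
Proof. exact: raddf_sum. Qed.

Lemma Re_mulrr z t : complex.Re (z * t%:C%C) = complex.Re z * t.
Proof. by case: z => a b /=; ring. Qed.

Lemma Im_mulrr z t : complex.Im (z * t%:C%C) = complex.Im z * t.
Proof. by case: z => a b /=; ring. Qed.

(** Differentiating in [t] along [1 - t * z] leaves the tail [w t] of a geometric series, of norm at
    most [r ^+ L.+1 / (1 - r)]. The mean value theorem is applied to each component, and adding the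
    two bounds gives the factor 2. *)
Lemma clog_series_remainder z r L : `|z| <= r%:C%C -> r < 1 ->
  `|- clog (1 - z) - \sum_(1 <= l < L.+1) z ^+ l / l%:R|
    <= (2 * (r ^+ L.+1 / (1 - r)))%:C%C.
Proof.
move=> zr r1; have r0 : 0 <= r by rewrite -lecR (le_trans _ zr) ?normr_ge0.
case: z zr => x y zr; set z := (x +i* y)%C in zr *.
have xr : x <= r by apply: le_trans (Re_norm_le zr); rewrite ler_norm.
have a0 t : t \in `[0, 1] -> 0 < 1 - t * x.
  by rewrite in_itv /= => /andP[t0 t1]; nra.
pose w t : R[i] := z / (1 - t%:C%C * z) - \sum_(1 <= l < L.+1) z ^+ l * (t ^+ l.-1)%:C%C.
have wM t : t \in `[0, 1] -> `|w t| <= (r ^+ L.+1 / (1 - r))%:C%C.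
  move=> t01; move: (t01); rewrite in_itv /= => /andP[t0 t1].
  have tzr : `|t%:C%C * z| <= r%:C%C.
    rewrite normrM norm_real_complex (ger0_norm t0); apply: le_trans zr.
    by rewrite ler_piMl // lecR.
  have lo : (1 - r)%:C%C <= `|1 - t%:C%C * z|.
    rewrite rmorphB /= (le_trans _ (lerB_dist _ _)) // normr1 lerD2l lerN2.
    exact: tzr.
  have d0 : 1 - t%:C%C * z != 0.
    by rewrite -normr_gt0 (lt_le_trans _ lo) // ltcR subr_gt0.
  have -> : w t = z * (t%:C%C * z) ^+ L / (1 - t%:C%C * z).
    rewrite /w big_add1 /=.
    have -> : \sum_(0 <= l < L) z ^+ l.+1 * (t ^+ l)%:C%C =
        z * \sum_(l < L) (t%:C%C * z) ^+ l.
      rewrite big_mkord mulr_sumr; apply: eq_bigr => l _.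
      by rewrite rmorphXn /= exprMn exprS; ring.
    apply: (mulIf d0); rewrite mulrBl !divfK // -mulrA.
    have := subrX1 (t%:C%C * z) L; set S := \sum_(i < L) _.
    set u := t%:C%C * z => e.
    have -> : S * (1 - u) = 1 - u ^+ L by rewrite -[RHS]opprB e; ring.
    by ring.
  rewrite normrM normfV normrM normrX.
  rewrite rmorphM fmorphV /= exprS rmorphM /= rmorphXn /=.
  apply: ler_pM; rewrite ?mulr_ge0 ?invr_ge0 ?exprn_ge0 ?normr_ge0 //.
    apply: ler_pM; rewrite ?exprn_ge0 ?normr_ge0 //.
    by apply: lerXn2r; rewrite ?nnegrE ?normr_ge0 // (le_trans _ zr).
  by rewrite lef_pV2 // posrE ?normr_gt0 // ltcR subr_gt0.
have den t : t \in `[0, 1] -> z / (1 - t%:C%C * z) =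
    ((((1 - t * x) * x - t * y * y) / ((1 - t * x) ^+ 2 + (- (t * y)) ^+ 2))
     +i* (y / ((1 - t * x) ^+ 2 + (- (t * y)) ^+ 2)))%C.
  move=> /a0 at0.
  have q0 : (1 - t * x) ^+ 2 + (- (t * y)) ^+ 2 != 0.
    by rewrite gt_eqF // ltr_wpDr ?sqr_ge0 ?exprn_gt0.
  have e1 : 1 - t%:C%C * z = ((1 - t * x) +i* (- (t * y)))%C.
    by apply/eqP; rewrite eq_complex /=; apply/andP; split; apply/eqP; ring.
  rewrite e1; apply: (@mulIf _ ((1 - t * x) +i* (- (t * y)))%C).
    by apply/eqP => -[] /eqP; rewrite gt_eqF.
  rewrite divfK; last by apply/eqP => -[] /eqP; rewrite gt_eqF.
  apply/eqP; rewrite eq_complex /=; apply/andP; split; apply/eqP; field.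
    by [].
  by [].
have ReB u v : complex.Re (u - v) = complex.Re u - complex.Re v :> R by exact: raddfB.
have ImB u v : complex.Im (u - v) = complex.Im u - complex.Im v :> R by exact: raddfB.
have w1 : clog (1 - z) = clog ((1 - x) +i* - y)%C.
  by congr clog; apply/eqP; rewrite eq_complex /= sub0r !eqxx.
(* The factors 1 are left in place to match the value [f 1] in [power_series_remainder]. *)
have ReM : `|- (ln ((1 - 1 * x) ^+ 2 + (- (1 * y)) ^+ 2) / 2)
   - \sum_(1 <= l < L.+1) complex.Re (z ^+ l) / l%:R| <= r ^+ L.+1 / (1 - r).
  apply: (power_series_remainder (fun t t01 => is_derive_half_ln y (a0 t t01))).
    by rewrite !mul0r subr0 oppr0 expr1n expr0n addr0 ln1 mul0r oppr0.
  move=> t t01; apply: le_trans (Re_norm_le (wM t t01)).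
  rewrite /w den // ReB Re_sum.
  by under [X in _ <= `|_ - X|]eq_bigr do rewrite Re_mulrr.
have ImM : `|- atan (- (1 * y) / (1 - 1 * x))
   - \sum_(1 <= l < L.+1) complex.Im (z ^+ l) / l%:R| <= r ^+ L.+1 / (1 - r).
  apply: (power_series_remainder (fun t t01 => is_derive_atan_quotient y (a0 t t01))).
    by rewrite !mul0r oppr0 mul0r atan0 oppr0.
  move=> t t01; apply: le_trans (Im_norm_le (wM t t01)).
  rewrite /w den // ImB Im_sum.
  by under [X in _ <= `|_ - X|]eq_bigr do rewrite Im_mulrr.
have -> : - clog (1 - z) - \sum_(1 <= l < L.+1) z ^+ l / l%:R =
  ((- (ln ((1 - 1 * x) ^+ 2 + (- (1 * y)) ^+ 2) / 2)
   - \sum_(1 <= l < L.+1) complex.Re (z ^+ l) / l%:R) +i*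
   (- atan (- (1 * y) / (1 - 1 * x))
   - \sum_(1 <= l < L.+1) complex.Im (z ^+ l) / l%:R))%C.
  have Vn l : (l%:R : R[i])^-1 = (l%:R^-1)%:C%C by rewrite fmorphV rmorph_nat.
  rewrite w1 clog_Re_gt0 ?mul1r; last first.
    by have := a0 1; rewrite mul1r; apply; rewrite in_itv /= ler01 lexx.
  apply/eqP; rewrite eq_complex ReB ImB Re_sum Im_sum /=.
  apply/andP; split; apply/eqP; congr (_ - _); apply: eq_bigr => l _.
    by rewrite Vn Re_mulrr.
  by rewrite Vn Im_mulrr.
apply: le_trans (norm_le_Re_Im _) _; rewrite lecR /=.
by rewrite mulr_natl mulr2n lerD.
Qed.

End ComplexLogarithm.

(** * Dirichlet series *)

Section ComplexConvergence.
Local Open Scope classical_set_scope.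
Variable R : realType.
Implicit Types (u v : nat -> R[i]) (l : R[i]).

Lemma ccvg_dominated u l (e : nat -> R) :
  (\forall n \near \oo, `|u n - l| <= (e n)%:C%C) -> e @ \oo --> (0 : R) ->
  ccvg u l.
Proof.
move=> ue e0; apply/(@cvgrPdist_lt _ (R[i]^o)) => eps eps0.
(* In the order of [R[i]] a positive element is real. *)
have epsE : eps = (complex.Re eps)%:C%C.
  by apply/eqP; rewrite eq_complex /= eqxx; move: eps0; rewrite ltcE /= => /andP[/eqP ->].
have d0 : 0 < complex.Re eps by rewrite -ltcR -epsE.
have /cvgrPdist_lt /(_ _ d0) en := e0.
apply: filterS2 ue en => n un_le; rewrite sub0r normrN => en_lt.
rewrite distrC epsE; apply: le_lt_trans un_le _.
by rewrite ltcR (le_lt_trans (ler_norm _)).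
Qed.

Lemma ccvg_Re u l : ccvg u l -> (fun n => complex.Re (u n)) @ \oo --> complex.Re l.
Proof.
move=> /(@cvgrPdist_lt _ (R[i]^o)) ul; apply/cvgrPdist_lt => e e0.
have e0C : 0 < e%:C%C :> R[i] by rewrite ltcR.
have := ul _ e0C; apply: filterS => n le_e; rewrite -ltcR.
have -> : complex.Re l - complex.Re (u n) = complex.Re (l - u n) :> R.
  by rewrite raddfB.
exact: le_lt_trans (normc_ge_Re _) le_e.
Qed.

Lemma ccvg_Im u l : ccvg u l -> (fun n => complex.Im (u n)) @ \oo --> complex.Im l.
Proof.
move=> /(@cvgrPdist_lt _ (R[i]^o)) ul; apply/cvgrPdist_lt => e e0.
have e0C : 0 < e%:C%C :> R[i] by rewrite ltcR.
have := ul _ e0C; apply: filterS => n.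
have -> : complex.Im l - complex.Im (u n) = complex.Im (l - u n) :> R.
  by rewrite raddfB.
have [q _ lq] := norm_complex_real (l - u n); rewrite lq ltcR => qe.
by apply: le_lt_trans qe; apply: Im_norm_le; rewrite lq.
Qed.

Lemma ccvg_components u l :
  (fun n => complex.Re (u n)) @ \oo --> complex.Re l ->
  (fun n => complex.Im (u n)) @ \oo --> complex.Im l -> ccvg u l.
Proof.
move=> ul1 ul2.
pose e n := `|complex.Re (u n) - complex.Re l| + `|complex.Im (u n) - complex.Im l|.
apply: (@ccvg_dominated _ _ e).
  apply: nearW => n; apply: le_trans (norm_le_Re_Im _) _.
  by rewrite lecR !raddfB.
have dist0 (a : nat -> R) b : a @ \oo --> b -> (fun n => `|a n - b|) @ \oo --> (0 : R).
  move=> ab; rewrite -(normr0 R) -(subrr b); apply: cvg_norm.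
  by apply: cvgB => //; exact: cvg_cst.
by rewrite -[0 : R]addr0; apply: cvgD; apply: dist0.
Qed.

Lemma ccvgM u v l l' : ccvg u l -> ccvg v l' -> ccvg (fun n => u n * v n) (l * l').
Proof. exact: (@cvgM R[i]). Qed.

Lemma ccvgD u v l l' : ccvg u l -> ccvg v l' -> ccvg (fun n => u n + v n) (l + l').
Proof. exact: (@cvgD R[i] (R[i]^o)). Qed.

Lemma ccvg_unique u l l' : ccvg u l -> ccvg u l' -> l = l'.
Proof. by move=> ul ul'; apply: (cvg_unique (@norm_hausdorff R[i] (R[i]^o)) ul ul'). Qed.

Lemma ccvg_clim u l : ccvg u l -> clim u = l.
Proof. by move=> ul; apply: (cvg_lim (@norm_hausdorff R[i] (R[i]^o)) ul). Qed.

End ComplexConvergence.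

(** * Absolutely convergent series and their Dirichlet products *)

Section DirichletSeries.
Local Open Scope classical_set_scope.
Variable R : realType.
Implicit Types (a : nat -> R) (w : R[i]).

Lemma is_cvg_sum_rpower (e : R) : 0 < e ->
  cvgn (fun N => \sum_(1 <= k < N.+1) expR (- ((1 + e) * ln k%:R)) : R).
Proof.
move=> e0; apply: nondecreasing_is_cvgn.
  apply/nondecreasing_seqP => N; rewrite [leRHS]big_nat_recr //=.
  by rewrite lerDl expR_ge0.
exists (1 + e^-1) => _ [N _ <-].
(* Telescoping: k^(-1-e) <= ((k-1)^-e - k^-e) / e. *)
have H M : \sum_(1 <= k < M.+2) expR (- ((1 + e) * ln k%:R))
    <= 1 + (1 - expR (- (e * ln M.+1%:R))) / e :> R.
  elim: M => [|M IH].
    by rewrite big_nat1 ln1 !mulr0 oppr0 expR0 subrr mul0r addr0.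
  rewrite big_nat_recr //=; apply: le_trans (lerD IH (lexx _)) _.
  set x : R := M.+2%:R; set y : R := M.+1%:R.
  have x0 : 0 < x by rewrite ltr0n.
  have y0 : 0 < y by rewrite ltr0n.
  have xy : x = y + 1 by rewrite /x /y natr1.
  (* From [ln (1 + u) <= u] at [u = - x^-1]. Below, [1 + v <= expR v] at [v = e / x] turns this gap
     into the telescoping inequality. *)
  have lnxy : ln y <= ln x - x^-1.
    have -> : y = x * (1 + - x^-1) by rewrite mulrDr mulr1 mulrN divff ?gt_eqF // xy addrK.
    have x1 : -1 < - x^-1 by rewrite ltrN2 invf_lt1 // xy ltrDr.
    rewrite lnM ?posrE ?lerD2l ?le_ln1Dx //.
    by rewrite -ltrBlDl sub0r.
  have ex : expR (- ((1 + e) * ln x)) = expR (- (e * ln x)) / x.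
    by rewrite mulrDl mul1r opprD expRD [expR (- ln x)]expRN lnK ?posrE // mulrC.
  have ey : expR (- (e * ln x)) * (1 + e / x) <= expR (- (e * ln y)).
    apply: (@le_trans _ _ (expR (- (e * ln x)) * expR (e / x))).
      by rewrite ler_pM2l ?expR_gt0 // expR_ge1Dx.
    rewrite -expRD ler_expR lerNr opprD opprK -mulrBr.
    by rewrite ler_pM2l.
  rewrite ex -addrA lerD2l ler_pdivlMr // mulrDl divfK ?gt_eqF //.
  move: ey; rewrite mulrDr mulr1; set A := expR _; set B := expR _.
  have -> : A / x * e = A * (e / x) by ring.
  by move: (A * (e / x)) => u; lra.
case: N => [|N]; first by rewrite big_geq // addr_ge0 ?invr_ge0 ?ltW.
apply: le_trans (H N) _; rewrite lerD2l ler_pdivrMr // mulVf ?gt_eqF //.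

Qed.

Lemma cvgn_complex_sum (t : nat -> R[i]) a :
  (forall k, (0 < k)%N -> `|t k| <= (a k)%:C%C) ->
  cvgn (fun N => \sum_(1 <= k < N.+1) a k) ->
  exists l, ccvg (fun N => \sum_(1 <= k < N.+1) t k) l.
Proof.
move=> ta a_cvg.
(* [series] sums from index 0, hence the shift. Comparison is then used on real and imaginary parts
   separately. *)
have a_cvg' : cvgn (series (fun k => a k.+1)).
  by move: a_cvg; under eq_fun do rewrite big_add1 /=.
have cvg_part (b : nat -> R) : (forall k, (0 < k)%N -> `|b k| <= a k) ->
    exists l : R, (fun N => \sum_(1 <= k < N.+1) b k) @ \oo --> l.
  move=> ba; exists (limn (series (fun k => b k.+1))).
  have -> : (fun N => \sum_(1 <= k < N.+1) b k) = series (fun k => b k.+1).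
    by apply/funext => N; rewrite big_add1.
  have b_cvg : cvgn (series (fun k => b k.+1)); last exact: b_cvg.
  apply: normed_cvg; apply: series_le_cvg a_cvg' => k /=.
  - by rewrite normr_ge0.
  - by rewrite (le_trans _ (ba _ _)) ?normr_ge0.
  - exact: ba.
have [|x xl] := cvg_part (fun k => complex.Re (t k)).
  by move=> k k0; apply: Re_norm_le; apply: ta.
have [|y yl] := cvg_part (fun k => complex.Im (t k)).
  by move=> k k0; apply: Im_norm_le; apply: ta.
exists (x +i* y)%C; apply: ccvg_components => /=.
  by under eq_fun do rewrite Re_sum.
by under eq_fun do rewrite Im_sum.
Qed.

(** If [M * M <= K], the region [k * l <= K] contains the square of side [M] and lies in that of
    side [K]. The sum over it is thus squeezed between two squares of partial sums with the same
    limit. *)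
Lemma hyperbola_square_cvg a : (forall k, 0 <= a k) ->
  cvgn (fun N => \sum_(1 <= k < N.+1) a k) ->
  (fun K => (\sum_(1 <= k < K.+1) a k) ^+ 2 -
    \sum_(1 <= k < K.+1) \sum_(1 <= l < K.+1 | (k * l <= K)%N) a k * a l)
  @ \oo --> (0 : R).
Proof.
move=> a0 a_cvg; set A := fun N => \sum_(1 <= k < N.+1) a k in a_cvg *.
pose H K := \sum_(1 <= k < K.+1) \sum_(1 <= l < K.+1 | (k * l <= K)%N) a k * a l.
pose L := limn A.
have A_ge0 N : 0 <= A N by apply: sumr_ge0.
have A_homo : {homo A : n m / (n <= m)%N >-> n <= m}.
  by apply/nondecreasing_seqP => N; rewrite /A [leRHS]big_nat_recr //= lerDl.
have A_le N : A N <= L := nondecreasing_cvgn_le A_homo a_cvg N.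
have A2E N : A N ^+ 2 = \sum_(1 <= k < N.+1) \sum_(1 <= l < N.+1) a k * a l.
  by rewrite expr2 mulr_suml; apply: eq_bigr => k _; rewrite mulr_sumr.
have A2_cvg : (fun N => A N ^+ 2) @ \oo --> L ^+ 2.
  by under eq_fun do rewrite expr2; rewrite expr2; apply: cvgM.
have HA K : H K <= A K ^+ 2.
  rewrite A2E; apply: ler_sum => k _; rewrite big_mkcond /=; apply: ler_sum => l _.
  by case: ifP => // _; rewrite mulr_ge0.
have AH M K : (M * M <= K)%N -> A M ^+ 2 <= H K.
  move=> MK; have MK1 : (M.+1 <= K.+1)%N.
    by rewrite ltnS (leq_trans _ MK) //; case: (M) => // j; rewrite leq_pmulr.
  rewrite A2E (big_nat_widen _ _ _ _ _ MK1) big_mkcond /= /H; apply: ler_sum => k _.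
  case: ifP => [|_]; last by apply: sumr_ge0 => l _; rewrite mulr_ge0.
  rewrite ltnS => kM; rewrite (big_nat_widen _ _ _ _ _ MK1) big_mkcond /=.
  rewrite [leRHS]big_mkcond /=; apply: ler_sum => l _.
  case: ifP => [|_]; last by case: ifP => // _; rewrite mulr_ge0.
  rewrite ltnS => lM; rewrite ifT //.
  by rewrite (leq_trans _ MK) // leq_mul.
have H_cvg : H @ \oo --> L ^+ 2.
  apply/cvgrPdist_lt => e e0.
  have /cvgrPdist_lt /(_ _ e0) [M _ /(_ M (leqnn M)) /= LM] := A2_cvg.
  exists (M * M)%N => // K /= MK; apply: le_lt_trans LM.
  have h1 := AH M K MK; have h2 := HA K.
  have h3 : A K ^+ 2 <= L ^+ 2 by rewrite lerXn2r ?nnegrE // (le_trans (A_ge0 K)).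
  rewrite !ger0_norm ?subr_ge0 ?lerD2l ?lerN2 //; lra.
rewrite -[X in _ --> X](subrr (L ^+ 2)); exact: (cvgB A2_cvg H_cvg).
Qed.

(* The two sums differ by the pairs (k, l) with kl > K, where k or l exceeds
   sqrt K, so the difference is a tail of the square of an absolutely convergent
   series. *)
Lemma dirichlet_product_cvg (f t : nat -> R[i]) a (B : R) :
  (forall k, 0 <= a k) -> (forall k, (0 < k)%N -> `|t k| = (a k)%:C%C) ->
  (forall k l, (0 < k)%N -> (0 < l)%N -> t (k * l)%N = t k * t l) ->
  (forall k, (0 < k)%N -> `|f k| <= B%:C%C) ->
  cvgn (fun N => \sum_(1 <= k < N.+1) a k) ->
  ccvg (fun K => (\sum_(1 <= k < K.+1) f k * t k) * (\sum_(1 <= k < K.+1) t k)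
     - \sum_(1 <= N < K.+1) (\sum_(d <- divisors N) f d) * t N) 0.
Proof.
move=> a0 ta tM fB a_cvg; have h := hyperbola_square_cvg a0 a_cvg.
apply: (@ccvg_dominated _ _ _ (fun K => B * ((\sum_(1 <= k < K.+1) a k) ^+ 2 -
    \sum_(1 <= k < K.+1) \sum_(1 <= l < K.+1 | (k * l <= K)%N) a k * a l)));
  last by rewrite -[X in _ --> X](mulr0 B); apply: cvgM h; exact: cvg_cst.
apply: nearW => K; rewrite subr0.
have -> : \sum_(1 <= N < K.+1) (\sum_(d <- divisors N) f d) * t N =
    \sum_(1 <= k < K.+1) \sum_(1 <= l < K.+1 | (k * l <= K)%N) f k * t k * t l.
  rewrite -(sum_divisors_hyperbola (fun k l => f k * t k * t l)).
  apply: eq_big_nat => N /andP[N0 _]; rewrite mulr_suml big_seq [RHS]big_seq.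
  apply: eq_bigr => d; rewrite -dvdn_divisors // => dN.
  have d0 := dvdn_gt0 N0 dN.
  have q0 : (0 < N %/ d)%N by rewrite divn_gt0 // dvdn_leq.
  by rewrite -mulrA -(tM _ _ d0 q0) [(d * _)%N]mulnC divnK.
have split (V : zmodType) (F : nat -> nat -> V) :
    \sum_(1 <= k < K.+1) \sum_(1 <= l < K.+1) F k l -
    \sum_(1 <= k < K.+1) \sum_(1 <= l < K.+1 | (k * l <= K)%N) F k l =
    \sum_(1 <= k < K.+1) \sum_(1 <= l < K.+1 | ~~ (k * l <= K)%N) F k l.
  rewrite -sumrB; apply: eq_bigr => k _.
  by rewrite (bigID (fun l => k * l <= K)%N) /= addrAC subrr add0r.
have sq (S : pzRingType) (x y : nat -> S) :
    (\sum_(1 <= k < K.+1) x k) * (\sum_(1 <= k < K.+1) y k) =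
    \sum_(1 <= k < K.+1) \sum_(1 <= l < K.+1) x k * y l.
  by rewrite mulr_suml; apply: eq_bigr => k _; rewrite mulr_sumr.
(* Both the error and its bound become sums over [k * l > K], compared term by term. *)
rewrite sq split expr2 sq split mulr_sumr rmorph_sum /=.
apply: le_trans (ler_norm_sum _ _ _) _; rewrite [leLHS]big_nat [leRHS]big_nat.
apply: ler_sum => k /andP[k0 _]; rewrite mulr_sumr rmorph_sum /=.
apply: le_trans (ler_norm_sum _ _ _) _; rewrite [leLHS]big_nat_cond [leRHS]big_nat_cond.
apply: ler_sum => l /andP[/andP[l0 _] _].
rewrite !normrM !ta // !rmorphM /= mulrA.
do 2! (apply: ler_wpM2r; first by rewrite lecR).
exact: fB.
Qed.

Lemma cpow_natE k w : (0 < k)%N -> cpow k%:R w = cexp (w * (ln k%:R)%:C%C).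
Proof.
move=> k0; rewrite /cpow; congr (cexp (w * _)).
have kR0 : 0 < k%:R :> R by rewrite ltr0n.
have -> : (k%:R : R[i]) = ((k%:R : R) +i* 0)%C by rewrite -(rmorph_nat (real_complex R)).
rewrite clog_Re_gt0 // expr0n addr0 mul0r atan0 lnXn // mulr2n.
by congr (_ +i* _)%C; field.
Qed.

Lemma norm_cpow_nat k w : (0 < k)%N ->
  `|cpow k%:R w| = (expR (complex.Re w * ln k%:R))%:C%C.
Proof. by move=> k0; rewrite cpow_natE // normc_cexp Re_mulrr. Qed.

Lemma cpow_natM k l w : (0 < k)%N -> (0 < l)%N ->
  cpow (k * l)%:R w = cpow k%:R w * cpow l%:R w.
Proof.
move=> k0 l0; rewrite !cpow_natE ?muln_gt0 ?k0 // natrM lnM ?posrE ?ltr0n //.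
by rewrite rmorphD mulrDr cexpD.
Qed.

Lemma cpow_natB k m w : (0 < k)%N -> cpow k%:R (m%:R - w) = k%:R ^+ m / cpow k%:R w.
Proof.
move=> k0; rewrite !cpow_natE // mulrBl cexpD cexpN cexpX.
congr (_ ^+ _ / _); rewrite /cexp /= cos0 sin0 mulr1 mulr0 lnK ?posrE ?ltr0n //.
by rewrite -(rmorph_nat (real_complex R)).
Qed.

Lemma norm_moebius k : `|moebius R[i] k| <= 1.
Proof.
rewrite /moebius; apply: (big_ind (fun x => `|x| <= 1)); first by rewrite normr1.
  by move=> x y x1 y1; rewrite normrM mulr_ile1.
by move=> p _; case: ifP; rewrite ?normrN1 ?normr0 ?ler01.
Qed.

Section HalfPlane.
Variable w : R[i].
Hypothesis w_gt1 : 1 < complex.Re w.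

Let a k : R := expR (- (complex.Re w * ln k%:R)).

Let a_cvg : cvgn (fun N => \sum_(1 <= k < N.+1) a k).
Proof.
have e0 : 0 < complex.Re w - 1 by rewrite subr_gt0.
by have := is_cvg_sum_rpower e0; rewrite addrC subrK.
Qed.

Let ta k : (0 < k)%N -> `|(cpow k%:R w)^-1| = (a k)%:C%C.
Proof. by move=> k0; rewrite normfV norm_cpow_nat // /a expRN fmorphV. Qed.

(** [zeta] is a [lim], which says nothing until a limit is exhibited. *)
Lemma zeta_cvg : ccvg (fun N => \sum_(1 <= k < N.+1) (cpow k%:R w)^-1) (zeta w).
Proof.
have [l hl] : exists l, ccvg (fun N => \sum_(1 <= k < N.+1) (cpow k%:R w)^-1) l.
  by apply: cvgn_complex_sum a_cvg => k k0; rewrite ta.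
by rewrite /zeta (ccvg_clim hl).
Qed.

(** Concludes with a product rather than a quotient because [zeta_neq0] is itself deduced from
    it. *)
Lemma dirichlet_series_mul_zeta (f : nat -> R[i]) (B : R) (D : R[i]) :
  (forall k, (0 < k)%N -> `|f k| <= B%:C%C) ->
  ccvg (fun K => \sum_(1 <= N < K.+1) (\sum_(d <- divisors N) f d) / cpow N%:R w) D ->
  exists2 c, ccvg (fun N => \sum_(1 <= k < N.+1) f k / cpow k%:R w) c &
    c * zeta w = D.
Proof.
move=> fB hD.
have [c hc] : exists c, ccvg (fun N => \sum_(1 <= k < N.+1) f k / cpow k%:R w) c.
  apply: (@cvgn_complex_sum _ (fun k => B * a k)) => [k k0|].
    by rewrite normrM ta // rmorphM ler_wpM2r ?fB // lecR expR_ge0.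
  under eq_fun do rewrite -mulr_sumr.
  by apply: is_cvgM => //; exact: is_cvg_cst.
exists c => //; apply: ccvg_unique (ccvgM hc zeta_cvg) _.
rewrite -[D]add0r.
have tM k l : (0 < k)%N -> (0 < l)%N ->
    (cpow (k * l)%:R w)^-1 = (cpow k%:R w)^-1 * (cpow l%:R w)^-1.
  by move=> k0 l0; rewrite cpow_natM // invfM.
have := ccvgD (dirichlet_product_cvg (fun k => expR_ge0 _) ta tM fB a_cvg) hD.
by under eq_fun do rewrite subrK.
Qed.

Lemma zeta_neq0 : zeta w != 0.
Proof.
have [||c _ c1] := @dirichlet_series_mul_zeta (moebius R[i]) 1 1.
- by move=> k _; apply: norm_moebius.
- apply: (@ccvg_dominated _ _ _ (fun=> 0)); last exact: cvg_cst.
  (* Only [N = 1] contributes, so the partial sums equal 1 from [K = 1] on; at [K = 0] the sum is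
     empty. *)
  exists 1%N => // K /= K0; rewrite big_ltn ?ltnS //.
  rewrite [X in _ + X - 1]big_nat [X in _ + X - 1]big1 ?addr0.
    by rewrite sum_moebius // eqxx div1r cpow_natE // ln1 mulr0 cexp0 invr1 subrr normr0.
  move=> N /andP[N1 _]; rewrite sum_moebius; last exact: ltnW.
  by rewrite gtn_eqF // mul0r.
apply/eqP => z0; move: c1; rewrite z0 mulr0 => /eqP.
by rewrite eq_sym oner_eq0.
Qed.

End HalfPlane.

End DirichletSeries.

(** * Infinite products *)

Section LambertProduct.
Local Open Scope classical_set_scope.
Variable R : realType.

Lemma ccvg_cexp (u : nat -> R[i]) l : ccvg u l -> ccvg (fun n => cexp (u n)) (cexp l).
Proof.
move=> ul.
have re := ccvg_Re ul; have im := ccvg_Im ul.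
have cE z : cexp z = ((expR (complex.Re z) * cos (complex.Im z)) +i*
  (expR (complex.Re z) * sin (complex.Im z)))%C :> R[i] by case: z.
have e1 : (fun n => expR (complex.Re (u n))) @ \oo --> expR (complex.Re l).
  by apply: continuous_cvg re; exact: continuous_expR.
apply: ccvg_components; rewrite cE /=.
  under eq_fun do rewrite cE /=; apply: cvgM => //.
  by apply: continuous_cvg im; exact: continuous_cos.
under eq_fun do rewrite cE /=; apply: cvgM => //.
by apply: continuous_cvg im; exact: continuous_sin.
Qed.

(** With [s] the square root of [r], a Bernoulli inequality bounds [K * s ^+ K] by the constant
    [(s^-1 - 1)^-1]; the other factor [s ^+ K] tends to 0. *)
Lemma cvg_nat_mul_exprn (r : R) : 0 < r < 1 ->
  (fun K => K%:R * r ^+ K) @ \oo --> (0 : R).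
Proof.
move=> /andP[r0 r1]; pose s := Num.sqrt r.
have s0 : 0 < s by rewrite sqrtr_gt0.
have rs : r = s ^+ 2 by rewrite sqr_sqrtr // ltW.
have s1 : s < 1 by rewrite -[X in _ < X]sqrtr1 ltr_sqrt.
have sV : 0 < s^-1 - 1 by rewrite subr_gt0 invf_gt1.
have bernoulli K : K%:R * (s^-1 - 1) <= (s ^+ K)^-1.
  rewrite -exprVn; elim: K => [|K IH]; first by rewrite mul0r expr0 ler01.
  have : 1 <= s^-1 ^+ K by rewrite exprn_ege1 // ltW // -subr_gt0.
  rewrite exprS -natr1 mulrDl mul1r; move: IH; set x := _ ^+ K; set y := K%:R.
  by nra.
apply: (@squeeze_cvgr _ _ _ _ (fun=> 0) (fun K => (s^-1 - 1)^-1 * s ^+ K)).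
- apply: nearW => K; rewrite mulr_ge0 ?ler0n ?exprn_ge0 ?(ltW r0) //=.
  rewrite rs -exprM mulnC exprM expr2 mulrA ler_wpM2r ?exprn_ge0 ?(ltW s0) //.
  have := bernoulli K; rewrite -(ler_pM2r (exprn_gt0 K s0)) mulVf ?expf_neq0 ?gt_eqF //.
  move=> h; rewrite -(ler_pM2l sV) divff ?gt_eqF //.
  by apply: le_trans h; rewrite mulrA [_ * K%:R]mulrC.
- exact: cvg_cst.
rewrite -(mulr0 (s^-1 - 1)^-1); apply: cvgM; first exact: cvg_cst.
by apply: cvg_expr; rewrite ger0_norm // ltW.
Qed.

(* With L = K / k, cutting the logarithm series of 1 - z^k after L terms keeps
   exactly the monomials z^(kl) with kl <= K. *)
Lemma sum_clog_cvg (f : nat -> R[i]) (B : R) z S : `|z| < 1 ->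
  (forall k, (0 < k)%N -> `|f k| <= B%:C%C) ->
  ccvg (fun K => \sum_(1 <= N < K.+1) (\sum_(d <- divisors N) f d) * z ^+ N / N%:R) S ->
  ccvg (fun K => \sum_(1 <= k < K.+1) - (f k / k%:R) * clog (1 - z ^+ k)) S.
Proof.
move=> z1 fB hS.
(* The midpoint of the norm of [z] and 1 is positive even when [z = 0]. *)
have [r /andP[r0 r1] zr] : exists2 r : R, 0 < r < 1 & `|z| <= r%:C%C.
  have [q q0 zq] := norm_complex_real z.
  move: z1; rewrite zq ltcR => q1; exists ((q + 1) / 2); last by rewrite lecR; lra.
  by apply/andP; split; lra.
(* The factor [2 / (1 - r)] comes from [clog_series_remainder]; the extra [r] from
   [k * (K %/ k).+1 >= K.+1]. *)
pose C := B * (2 * (r / (1 - r))).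
pose D K := \sum_(1 <= N < K.+1) (\sum_(d <- divisors N) f d) * z ^+ N / N%:R.
rewrite -[S]add0r.
have E K : \sum_(1 <= k < K.+1) - (f k / k%:R) * clog (1 - z ^+ k) =
   (\sum_(1 <= k < K.+1) - (f k / k%:R) * clog (1 - z ^+ k) - D K) + D K.
  by rewrite subrK.
under eq_fun do rewrite E.
apply: ccvgD hS; apply: (@ccvg_dominated _ _ _ (fun K => C * (K%:R * r ^+ K))).
  2: by rewrite -(mulr0 C); apply: cvgM; [exact: cvg_cst|apply: cvg_nat_mul_exprn; rewrite r0].
apply: nearW => K; rewrite subr0.
have -> : D K = \sum_(1 <= k < K.+1) f k / k%:R *
    \sum_(1 <= l < (K %/ k).+1) (z ^+ k) ^+ l / l%:R.
  transitivity (\sum_(1 <= k < K.+1) \sum_(1 <= l < K.+1 | (k * l <= K)%N)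
      f k * (z ^+ (k * l) / (k * l)%:R)).
    rewrite -(sum_divisors_hyperbola (fun k l => f k * (z ^+ (k * l) / (k * l)%:R))).
    apply: eq_big_nat => N /andP[N0 _]; rewrite -mulrA mulr_suml big_seq [RHS]big_seq.
    apply: eq_bigr => d; rewrite -dvdn_divisors // => dN.
    by rewrite mulnC divnK.
  apply: eq_big_nat => k /andP[k0 _].
  rewrite (big_nat_widen _ (K %/ k).+1 K.+1); last by rewrite ltnS leq_div.
  rewrite mulr_sumr; apply: eq_big => l.
    by rewrite /= ltnS leq_divRL // mulnC.
  by move=> _; rewrite natrM invfM exprM; ring.
rewrite -sumrB; apply: le_trans (ler_norm_sum _ _ _) _.
(* Each of the [K] logarithms contributes an error of at most [C * r ^+ K], uniformly in [k]. *)
have -> : C * (K%:R * r ^+ K) = \sum_(1 <= k < K.+1) C * r ^+ K.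
  by rewrite sumr_const_nat subSS subn0 -mulr_natl; ring.
rewrite rmorph_sum /= big_nat [leRHS]big_nat; apply: ler_sum => k /andP[k0 _].
have -> : - (f k / k%:R) * clog (1 - z ^+ k) - f k / k%:R *
    (\sum_(1 <= l < (K %/ k).+1) (z ^+ k) ^+ l / l%:R) = f k / k%:R *
    (- clog (1 - z ^+ k) - \sum_(1 <= l < (K %/ k).+1) (z ^+ k) ^+ l / l%:R).
  by ring.
have r0' := ltW r0.
have rk1 : r ^+ k <= r by rewrite -[leRHS]expr1 ler_wiXn2l // ltW.
have zk : `|z ^+ k| <= (r ^+ k)%:C%C.
  rewrite normrX rmorphXn /= lerXn2r ?nnegrE ?normr_ge0 //.
  by rewrite (le_trans _ zr).
have hlog := @clog_series_remainder _ _ _ (K %/ k) zk (le_lt_trans rk1 r1).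
rewrite normrM; have -> : C * r ^+ K = B * (2 * (r ^+ K.+1 / (1 - r))).
  by rewrite /C exprS; ring.
rewrite rmorphM; apply: ler_pM; rewrite ?normr_ge0 //.
  rewrite normrM; apply: le_trans (fB k k0); rewrite ler_piMr ?normr_ge0 //.
  by rewrite normfV normr_nat invf_le1 ?ltr0n // ler1n.
apply: le_trans hlog _; rewrite lecR ler_pM2l //.
apply: ler_pM; rewrite ?exprn_ge0 ?invr_ge0 //.
- by rewrite subr_ge0 ltW // (le_lt_trans rk1).
- by rewrite -exprM ler_wiXn2l // ?(ltW r1) // mulnC ltn_ceil.
rewrite lef_pV2 ?posrE ?subr_gt0 //; last exact: le_lt_trans r1.
by rewrite lerD2l lerN2.
Qed.

End LambertProduct.

(** * Bounds and limits for the Ramanujan function *)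

Section RamanujanSums.
Variables (R : realType) (m : nat) (n : 'I_m -> nat).
Hypothesis g_gt0 : (0 < gcd_fam n)%N.

(** In the convolution only common divisors of [k] and the gcd survive; summing over all divisors of
    the gcd makes the bound uniform in [k]. *)
Lemma norm_ramanujan_le k : (0 < k)%N ->
  `|ramanujan R k n| <= (\sum_(d <- divisors (gcd_fam n)) d%:R ^+ m)%:C%C.
Proof.
move=> k0; rewrite ramanujan_dconv // dconvC // /dconv rmorph_sum /=.
apply: le_trans (ler_norm_sum _ _ _) _.
have F_ge0 d : 0 <= (d%:R ^+ m : R)%:C%C :> R[i] by rewrite lecR exprn_ge0.
apply: (@le_trans _ _ (\sum_(d <- divisors k | (d %| gcd_fam n)%N) (d%:R ^+ m)%:C%C)).
  rewrite [leRHS]big_mkcond /=; apply: ler_sum => d _.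
  rewrite normrM /power_divisor; case: ifP => _; last by rewrite normr0 mul0r.
  apply: le_trans (ler_piMr _ (norm_moebius _ _)) _; first exact: normr_ge0.
  by rewrite normrX normr_nat rmorphXn rmorph_nat.
have E : perm_eq [seq d <- divisors k | (d %| gcd_fam n)%N]
    [seq d <- divisors (gcd_fam n) | (d %| k)%N].
  apply: uniq_perm; rewrite ?filter_uniq ?divisors_uniq // => d.
  by rewrite !mem_filter -!dvdn_divisors // andbC.
rewrite -[leLHS]big_filter (perm_big _ E) /= [leLHS]big_filter [leLHS]big_mkcond /=.
by apply: ler_sum => d _; case: ifP.
Qed.

(** The inner sum is [power_divisor N], so the partial sums are constant from [K = gcd_fam n] on.
    [F] is general in order to serve both the Dirichlet series and the product. *)
Lemma sum_power_divisor_cvg (F : nat -> R[i]) :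
  ccvg (fun K => \sum_(1 <= N < K.+1) (\sum_(d <- divisors N) ramanujan R d n) * F N)
    (\sum_(d <- divisors (gcd_fam n)) d%:R ^+ m * F d).
Proof.
apply: (@ccvg_dominated _ _ _ (fun=> 0)); last exact: cvg_cst.
exists (gcd_fam n) => // K /= gK.
rewrite (perm_big _ (perm_divisors_range (K := K) _)) ?g_gt0 //= big_filter.
rewrite [X in _ - X]big_mkcond /= -sumrB big_nat big1 ?normr0 // => N /andP[N0 _].
by rewrite sum_ramanujan // /power_divisor; case: ifP => _; rewrite ?mul0r subrr.
Qed.

End RamanujanSums.

Theorem theorem2p2 (R : realType) (m : nat) (n : 'I_m -> nat)
    (m_gt0 : (0 < m)%N) (n_gt0 : forall i : 'I_m, (0 < n i)%N) :
  (forall s : R[i], 0 < complex.Re s ->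
     ccvg (fun N : nat =>
             \sum_(1 <= k < N.+1) ramanujan R k n / cpow k%:R (s + 1))
          (sigma (- s - 1 + m%:R) (gcd_fam n) / zeta (s + 1))) /\
  (forall z : R[i], `|z| < 1 ->
     ccvg (fun N : nat =>
             \prod_(1 <= k < N.+1)
               cpow (1 - z ^+ k) (- (ramanujan R k n / k%:R)))
          (cexp (\sum_(k <- divisors (gcd_fam n)) k%:R ^+ m.-1 * z ^+ k))).
Proof.
(* A zero gcd would divide the positive entry at index 0, which exists since [m > 0]. *)
have g_gt0 : (0 < gcd_fam n)%N.
  rewrite lt0n; apply/negP => /eqP g0; have := n_gt0 (Ordinal m_gt0).
  have : (0 %| gcd_fam n)%N by rewrite g0.
  by rewrite dvdn_gcd_fam => /forallP/(_ (Ordinal m_gt0)); rewrite dvd0n lt0n => ->.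
have fB := norm_ramanujan_le R g_gt0; split=> [s s_gt0 | z z_lt1].
  have w_gt1 : 1 < complex.Re (s + 1) by rewrite raddfD /= ltrDr.
  have [c cvg_c <-] : exists2 c,
      ccvg (fun N => \sum_(1 <= k < N.+1) ramanujan R k n / cpow k%:R (s + 1)) c &
      c * zeta (s + 1) = sigma (- s - 1 + m%:R) (gcd_fam n).
    apply: (dirichlet_series_mul_zeta w_gt1 fB).
    have -> : sigma (- s - 1 + m%:R) (gcd_fam n) =
        \sum_(d <- divisors (gcd_fam n)) d%:R ^+ m / cpow d%:R (s + 1).
      rewrite /sigma big_seq [RHS]big_seq; apply: eq_bigr => d.
      rewrite -dvdn_divisors // => dg; have d_gt0 := dvdn_gt0 g_gt0 dg.
      by rewrite -cpow_natB //; congr cpow; ring.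
    exact: (sum_power_divisor_cvg g_gt0 (F := fun N => (cpow N%:R (s + 1))^-1)).
  by rewrite mulfK // zeta_neq0.
(* [cpow] is an exponential by definition, so a partial product is [cexp] of a finite sum, whatever
   the branch of the logarithm; it suffices that the exponents converge. *)
under eq_fun do rewrite -cexp_sum.
apply: ccvg_cexp; apply: (sum_clog_cvg z_lt1 fB).
(* Since [m > 0], the division by [k] lowers the exponent from [m] to [m.-1]. *)
have -> : \sum_(k <- divisors (gcd_fam n)) k%:R ^+ m.-1 * z ^+ k =
    \sum_(k <- divisors (gcd_fam n)) k%:R ^+ m * (z ^+ k / k%:R).
  rewrite big_seq [RHS]big_seq; apply: eq_bigr => d.
  rewrite -dvdn_divisors // => dg; have d_gt0 := dvdn_gt0 g_gt0 dg.
  rewrite -{2}(prednK m_gt0) exprSr mulrACA divff ?mulr1 //.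
  by rewrite pnatr_eq0 -lt0n.
under eq_fun do under eq_bigr do rewrite -mulrA.
exact: (sum_power_divisor_cvg g_gt0 (F := fun N => z ^+ N / N%:R)).
Qed.
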